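(* Let $q\geq 3$ be a prime power and let $\mathcal{B}_q$ be the incidence graph of the biaffine plane over $\mathbb{F}_q$. Then $\mathcal{B}_q$ is an $egr(2q^2,\,q,\,6,\,(q-1)^2(q-2))$.
   Context: All graphs are simple (no loops, no multiple edges). The girth of a graph is the length of its shortest cycles; the order is its number of vertices. An $egr(v,k,g,\lambda)$ (edge-girth-regular graph) is a $k$-regular graph of order $v$ and girth $g$ such that each of its edges is contained in exactly $\lambda$ distinct $g$-cycles (cycles of length $g$). Let $\mathbb{F}_q$ be the finite field with $q$ elements. The biaffine plane has point set $\mathscr{P}=\mathbb{F}_q\times\mathbb{F}_q$, with elements written $(x,y)$, and line set $\mathscr{L}=\mathbb{F}_q\times\mathbb{F}_q$, with elements written $[m,b]$, where $[m,b]=\{(x,mx+b): x\in\mathbb{F}_q\}$. The graph $\mathcal{B}_q$ is the bipartite incidence graph with vertex set the disjoint union $\mathscr{P}\sqcup\mathscr{L}$, in which $(x,y)\in\mathscr{P}$ is adjacent to $[m,b]\in\mathscr{L}$ if and only if $y=mx+b$. *)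

(* Defs.v *)
From HB Require Import structures.
From mathcomp Require Import all_boot all_order all_algebra.

Set Implicit Arguments.
Unset Strict Implicit.
Unset Printing Implicit Defensive.

Import GRing.Theory.

Record sgraph := SGraph {
  vertex :> finType;
  adj : rel vertex;
  adj_sym : symmetric adj;
  adj_irr : irreflexive adj
}.

Section Cycles.
Variable G : sgraph.

Definition regular (k : nat) : Prop :=
  forall x : G, #|[set y | adj x y]| = k.

(* [next s x] is the cyclic successor of [x] in [s] *)
Definition cycle_edges (s : seq G) : {set {set G}} :=
  [set [set x; next s x] | x in s].

(* A cycle is a subgraph, represented by its edge set, so that the choice of a
   starting vertex and of a direction does not matter.  The bound [3 <= n] is
   needed since [ucycleb] also accepts the empty sequence and [:: x; y] with
   [adj x y]. *)
Definition cycles (n : nat) : {set {set {set G}}} :=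
  [set cycle_edges s | s : n.-tuple G & (3 <= n) && ucycleb (@adj G) s].

Definition has_girth (g : nat) : Prop :=
  cycles g != set0 /\ forall n, n < g -> cycles n = set0.

Definition cycles_through (n : nat) (x y : G) : {set {set {set G}}} :=
  [set C in cycles n | [set x; y] \in C].

End Cycles.

Definition egr (v k g lambda : nat) (G : sgraph) : Prop :=
  [/\ #|G| = v, regular G k, has_girth G g &
      forall x y : G, adj x y -> #|cycles_through g x y| = lambda].

Section Biaffine.
Variable F : finFieldType.

Definition incident (p l : F * F) : bool :=
  let: (x, y) := p in let: (m, b) := l in (y == m * x + b)%R.

(* [inl] embeds the points (x, y), [inr] the lines [m, b]. *)
Definition biaffine_adj : rel ((F * F) + (F * F))%type := fun u w =>
  match u, w with
  | inl p, inr l | inr l, inl p => incident p l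
  | _, _ => false
  end.

Lemma biaffine_adj_sym : symmetric biaffine_adj.
Proof. by case=> u [] w. Qed.

Lemma biaffine_adj_irr : irreflexive biaffine_adj.
Proof. by case. Qed.

Definition biaffine_graph : sgraph := SGraph biaffine_adj_sym biaffine_adj_irr.

End Biaffine.

(* Main.v *)
Require Import Defs.
From HB Require Import structures.
From mathcomp Require Import all_boot all_order all_algebra ring.

Set Implicit Arguments.
Unset Strict Implicit.
Unset Printing Implicit Defensive.

Import GRing.Theory.

(** A cycle is an edge set, hence is traced by many vertex sequences; but once
    an edge xy of it is chosen, exactly one of them starts with x, y.  Counting
    the cycles of length m + 2 through xy therefore amounts to counting the
    m-tuples that complete x, y to a closed walk without repeated vertices
    ([card_cycles_through]).

    In the biaffine plane two points with distinct abscissae lie on exactly one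
    line, and two points with the same abscissa on none.  So two points have at
    most one common line, which excludes 4-cycles, while bipartiteness excludes
    odd cycles: the girth is at least 6.  A 6-cycle through an incident pair
    (p, l) consists of p, of a second point p1 of l, of a point p2 outside l
    whose abscissa differs from those of p and p1, and of the lines l, p1p2 and
    p2p, which these points determine ([ucycle6_biaffine]).

    If p = (x, y) and l has slope m, then p1 = p + u (1, m) with u <> 0 and
    p2 = p + u r (1, m) + (0, z) with r different from 0 and 1, and z <> 0.
    Writing the abscissa of p2 as x + u r makes the three parameters u, r, z
    independent of each other, so that there are (q - 1) (q - 2) (q - 1) such
    cycles.  As this number is positive for q >= 3, the girth is exactly 6. *)

(** * Cycles through an edge of a graph *)

Section RootedCycles.
Variable G : sgraph.
Implicit Types (x y z w : G) (s t : seq G).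

(** Adjacency inside a cycle is being consecutive in one of the two directions;
    this lets the cyclic order be read off the edge set. *)
Lemma in_cycle_edges s z w : uniq s ->
  ([set z; w] \in cycle_edges s) =
    [&& z \in s, w \in s & (w == next s z) || (z == next s w)].
Proof.
move=> Us; apply/imsetP/idP => [[u us eq_zw] | /and3P[zs ws]].
  (* Equal unordered pairs need inclusions both ways: if z = w, it is the
     converse one that forces next s u = u. *)
  have [] := (set21 z w, set22 z w); rewrite eq_zw.
  move=> /set2P zu /set2P wu.
  have /set2P uz : u \in [set z; w] by rewrite eq_zw set21.
  have /set2P nz : next s u \in [set z; w] by rewrite eq_zw set22.
  have zs : z \in s by case: zu => ->; rewrite ?mem_next.
  have ws : w \in s by case: wu => ->; rewrite ?mem_next.
  rewrite zs ws /=; move: {eq_zw} zs ws => _ _.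
  by case: zu wu => zu [] wu; rewrite {z}zu {w}wu ?eqxx ?orbT // in uz nz *;
     [case: nz => -> | case: uz => e; rewrite -!e]; rewrite eqxx.
by case/orP=> /eqP ->; [exists z | exists w; rewrite // setUC].
Qed.

Lemma eq_cycle_edges s t : s =i t -> next s =1 next t ->
  cycle_edges s = cycle_edges t.
Proof.
move=> eq_s eq_n; apply/setP=> e.
by apply/imsetP/imsetP=> -[u us ->]; exists u; rewrite ?eq_n // ?eq_s // -eq_s.
Qed.

Lemma cycle_edges_rot i s : uniq s -> cycle_edges (rot i s) = cycle_edges s.
Proof.
by move=> Us; apply: eq_cycle_edges => [z|]; [exact: mem_rot | exact: next_rot].
Qed.

Lemma cycle_edges_rev s : uniq s -> cycle_edges (rev s) = cycle_edges s.
Proof.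
move=> Us; apply/setP=> e; apply/imsetP/imsetP=> -[u].
  rewrite mem_rev next_rev // => us ->; exists (prev s u); rewrite ?mem_prev //.
  by rewrite next_prev // setUC.
move=> us ->; exists (next s u); rewrite ?mem_rev ?mem_next //.
by rewrite next_rev // prev_next // setUC.
Qed.

(** This is where the length of a cycle being at least 3 matters: the two
    neighbours of a vertex are distinct. *)
Lemma next_next_neq s z : uniq s -> 2 < size s -> z \in s ->
  next s (next s z) != z.
Proof.
move=> Us s3 zs; case: (rot_to zs) => i t def_t.
rewrite -!(next_rot i Us); move: s3 (Us); rewrite -(size_rot i) -(rot_uniq i) def_t.
case: t {def_t} => [|a [|b t]] //= _; rewrite !inE !eqxx.
case: (a =P z) => [-> | _] //=; first by rewrite eqxx.
by rewrite !negb_or [b == z]eq_sym => /andP[/and3P[]].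
Qed.

(** Two cyclic orders with the same edges that leave z in the same direction
    never part: after u, v, the next vertex is the only neighbour of v other
    than u. *)
Lemma iter_next_eq s t z : uniq s -> uniq t -> 2 < size s ->
    z \in s -> z \in t -> next s z = next t z ->
    cycle_edges s = cycle_edges t ->
  forall i, iter i (next s) z = iter i (next t) z.
Proof.
move=> Us Ut s3 zs zt eq_z eq_e i.
suff [] : iter i (next s) z = iter i (next t) z /\
          iter i.+1 (next s) z = iter i.+1 (next t) z by [].
elim: i => [|i [IH IH1]] //; split=> //.
set u := iter i (next s) z in IH IH1.
have us : u \in s by rewrite /u; elim: (i) => //= j; rewrite mem_next.
have : [set next s u; next s (next s u)] \in cycle_edges t.
  by rewrite -eq_e in_cycle_edges // !mem_next us eqxx.
have eq_u : next s u = next t u by rewrite [LHS]IH1 /= -IH.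
rewrite in_cycle_edges // => /and3P[_ _ /orP[/eqP | ]].
  by move=> e; rewrite !iterS -/u e eq_u IH.
by rewrite {1}eq_u (can_eq (prev_next Ut)) eq_sym (negPf (next_next_neq _ _ us)).
Qed.

Lemma traject_next x s : uniq (x :: s) ->
  x :: s = traject (next (x :: s)) x (size (x :: s)).
Proof.
move=> Us; have : fpath (next (x :: s)) x (rcons s x) := cycle_next Us.
rewrite rcons_path => /andP[/fpathE eq_s _].
by rewrite [LHS](congr1 (cons x) eq_s).
Qed.

Lemma cycle_edges_inj x y s t : uniq [:: x, y & s] -> uniq [:: x, y & t] ->
    0 < size s -> size s = size t ->
    cycle_edges [:: x, y & s] = cycle_edges [:: x, y & t] ->
  s = t.
Proof.
move=> Us Ut s_gt0 eq_sz eq_e; set s' := [:: x, y & s]; set t' := [:: x, y & t].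
have eq_it i : iter i (next s') x = iter i (next t') x.
  by apply: iter_next_eq => //; rewrite ?mem_head //= eqxx.
have sz_s : size s' = size t' by rewrite /= eq_sz.
suff [] : s' = t' by [].
rewrite /s' /t' (traject_next Us) (traject_next Ut) -/s' -/t' sz_s.
apply: (@eq_from_nth _ x) => [|i]; rewrite !size_traject // => lt_i.
by rewrite !nth_traject.
Qed.

Lemma rooted_cycle x y s :
    1 < size s -> ucycleb (@adj G) s -> x \in s -> next s x = y ->
  exists2 t, ucycleb (@adj G) [:: x, y & t] &
    size [:: x, y & t] = size s /\ cycle_edges [:: x, y & t] = cycle_edges s.
Proof.
move=> s2 Cs xs nx; case/andP: (Cs) => _ Us.
case: (rot_to xs) => i t def_t.
have := cycle_edges_rot i Us; have := next_rot i Us x; have := size_rot i s.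
have : ucycleb (@adj G) (rot i s) by rewrite /ucycleb rot_cycle rot_uniq.
rewrite {}def_t nx; case: t => [|a t] Ct /=.
  by move=> e; rewrite -e in s2.
by rewrite eqxx => sz_t a_y <-; exists t; rewrite -a_y.
Qed.

Lemma cycles_throughE m x y : 0 < m -> x != y ->
  cycles_through m.+2 x y =
    [set cycle_edges [:: x, y & s] | s : m.-tuple G &
       ucycleb (@adj G) [:: x, y & s]].
Proof.
move=> m_gt0 neq_xy; apply/setP=> C; rewrite inE; apply/andP/imsetP.
  case=> /imsetP[s]; rewrite inE => /andP[_ Cs] -> {C}.
  have Us : uniq s by case/andP: Cs.
  rewrite in_cycle_edges // => /and3P[xs ys next_xy].
  suff [t Ct [sz_t eq_t]] : exists2 t, ucycleb (@adj G) [:: x, y & t] &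
      size [:: x, y & t] = size s /\ cycle_edges [:: x, y & t] = cycle_edges s.
    rewrite size_tuple in sz_t; case: sz_t => /eqP sz_t.
    by exists (Tuple sz_t); rewrite ?inE.
  case/orP: next_xy => /eqP next_xy; first by apply: rooted_cycle; rewrite ?size_tuple.
  (* Here s traverses the edge from y to x, so its reversal is rooted. *)
  have [||||t Ct [sz_t eq_t]] := @rooted_cycle x y (rev s);
    rewrite ?size_rev ?size_tuple ?mem_rev //.
  - case/andP: Cs => Cs _; rewrite /ucycleb rev_uniq Us andbT rev_cycle.
    by rewrite (eq_cycle (e' := @adj G)) // => u v; rewrite adj_sym.
  - by rewrite next_rev // next_xy (prev_next Us).
  by exists t; rewrite // sz_t eq_t (cycle_edges_rev Us) size_rev size_tuple.
case=> s; rewrite inE => Cs ->; have Us : uniq [:: x, y & s] by case/andP: Cs.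
split; last by rewrite in_cycle_edges // !inE /= !eqxx orbT.
by apply/imsetP; exists [tuple of [:: x, y & s]]; rewrite // inE Cs andbT !ltnS.
Qed.

(** Rooting at the edge xy makes the vertex sequence of a cycle unique, since
    it fixes both the starting point and the direction. *)
Lemma card_cycles_through m x y : 0 < m -> x != y ->
  #|cycles_through m.+2 x y| =
    #|[set s : m.-tuple G | ucycleb (@adj G) [:: x, y & s]]|.
Proof.
move=> m_gt0 neq_xy; rewrite cycles_throughE // card_in_imset // => s t.
rewrite !inE => /andP[_ Us] /andP[_ Ut] eq_e; apply: val_inj.
by apply: cycle_edges_inj eq_e => //; rewrite !size_tuple.
Qed.

Lemma cycles_throughC n x y : cycles_through n x y = cycles_through n y x.
Proof. by rewrite /cycles_through setUC. Qed.

Lemma cycles_eq0 n :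
    (forall s, size s = n -> 3 <= n -> ~~ ucycleb (@adj G) s) ->
  cycles G n = set0.
Proof.
move=> no_cycle; apply/setP=> C; rewrite inE; apply/imsetP=> -[s].
by rewrite inE => /andP[n3 Cs]; rewrite (negPf (no_cycle s _ n3)) ?size_tuple in Cs.
Qed.

End RootedCycles.

(** * The biaffine plane and its incidence graph *)

Section BiaffinePlane.
Variable F : finFieldType.
Implicit Types (p r l : F * F).
Local Notation B := (biaffine_graph F).
Local Open Scope ring_scope.

(** The line through p and r when p.1 != r.1.  If p.1 = r.1 the quotient is 0
    and this is the horizontal line through p, a meaningless default value. *)
Definition joining p r : F * F :=
  let m := (r.2 - p.2) / (r.1 - p.1) in (m, p.2 - m * p.1).

Lemma joiningP p r l : p.1 != r.1 ->
  (incident p l && incident r l) = (l == joining p r).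
Proof.
case: p r l => x y [x' y'] [m b]; rewrite /joining /= => neq_x.
have nz : x' - x != 0 by rewrite subr_eq0 eq_sym.
apply/andP/eqP => [[/eqP-> /eqP->] | [-> ->]].
  by congr (_, _); field.
by split; apply/eqP; field.
Qed.

Lemma incident_neq1 p r l : incident p l -> incident r l -> p != r -> p.1 != r.1.
Proof.
case: p r l => x y [x' y'] [m b] /= /eqP-> /eqP->.
by apply: contraNneq => ->.
Qed.

Lemma card_biaffine : #|B| = (2 * #|F| ^ 2)%N.
Proof. by rewrite card_sum !card_prod mulnn addnn mul2n. Qed.

Lemma regular_biaffine : regular B #|F|.
Proof.
case=> -[a b].
  rewrite -[RHS](card_imset (f := fun m => inr (m, b - m * a) : B));
    last by move=> m n [].
  apply: eq_card => -[p|[m c]]; rewrite inE /=; first by apply/esym/imsetP=> -[].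
  apply/eqP/imsetP => [->|[n _ [-> ->]]]; last by rewrite addrC subrK.
  by exists m; rewrite // addrAC subrr add0r.
rewrite -[RHS](card_imset (f := fun x => inl (x, a * x + b) : B));
  last by move=> x y [].
apply: eq_card => -[[x y]|l]; rewrite inE /=; last by apply/esym/imsetP=> -[].
by apply/eqP/imsetP => [->|[z _ [-> ->]]] //; exists x.
Qed.

Lemma odd_cycle_biaffine (s : seq B) : cycle (@adj B) s -> ~~ odd (size s).
Proof.
pose side (u : B) := if u is inl _ then true else false.
suff alt u t : path (@adj B) u t -> side (last u t) = side u (+) odd (size t).
  case: s => //= u t /alt; rewrite last_rcons size_rcons /=.
  by case: (side u) (odd _) => [] [].
elim: t u => [|v t IH] u; rewrite ?addbF //= => /andP[uv /IH ->].
by case: u v uv => [p|l] [r|n] //= _; case: odd.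
Qed.

(** A 4-cycle would be two points on two common lines. *)
Lemma no_cycle4_biaffine (s : seq B) : size s = 4 -> ~~ ucycleb (@adj B) s.
Proof.
have two_points p r l n : incident p l -> incident r l ->
    incident p n -> incident r n -> (p == r) || (l == n).
  move=> pl rl pn rn; case: (eqVneq p r) => //= neq_pr.
  have neq_x := incident_neq1 pl rl neq_pr.
  have /eqP-> : l == joining p r by rewrite -joiningP ?pl.
  by rewrite eq_sym -joiningP ?pn.
case: s => [|a [|b [|c [|d []]]]] // _; apply/negP; rewrite /ucycleb /= !inE !negb_or.
case: a b c d => [a|a] [b|b] [c|c] [d|d]; rewrite ?andbF //= !andbT.
  case/and3P=> /and4P[ab cb cd ad] ac bd.
  by case/orP: (two_points a c b d ab cb ad cd) => /eqP e; rewrite e eqxx in ac bd.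
case/and3P=> /and4P[ba bc dc da] ac bd.
by case/orP: (two_points b d a c ba da bc dc) => /eqP e; rewrite e eqxx in ac bd.
Qed.

(** * Counting the 6-cycles through an edge *)

(** The conditions on the three points suffice: the lines are then distinct
    because p2 lies on l1 and l2 but not on l, and because l1 = l2 would pass
    through p and p1, hence be l. *)
Lemma ucycle6_biaffine p l p1 l1 p2 l2 : incident p l ->
  ucycleb (@adj B) [:: inl p; inr l; inl p1; inr l1; inl p2; inr l2] =
  [&& incident p1 l, p1.1 != p.1, p2.1 != p.1, p2.1 != p1.1, ~~ incident p2 l,
      l1 == joining p1 p2 & l2 == joining p2 p].
Proof.
move=> pl; rewrite /ucycleb /= !inE !negb_or pl /= !andbT.
apply/idP/idP.
  case/andP=> /and5P[p1l p1l1 p2l1 p2l2 pl2].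
  case/and4P=> /andP[pp1 pp2] /andP[ll1 _] p1p2 _.
  have p1x : p1.1 != p.1.
    by apply: incident_neq1 p1l pl _; apply: contraNneq pp1 => ->.
  have p2x : p2.1 != p.1.
    by apply: incident_neq1 p2l2 pl2 _; apply: contraNneq pp2 => ->.
  have p12 : p1.1 != p2.1.
    by apply: incident_neq1 p1l1 p2l1 _; apply: contraNneq p1p2 => ->.
  have /eqP def_l1 : l1 == joining p1 p2 by rewrite -joiningP // p1l1.
  rewrite p1l p1x p2x [p2.1 == _]eq_sym p12 def_l1 eqxx -joiningP // p2l2 pl2.
  rewrite /= andbT.
  apply: contra ll1 => p2l; rewrite def_l1.
  have /eqP-> // : l == joining p1 p2 by rewrite -joiningP // p1l.
case/and5P=> p1l p1x p2x; rewrite eq_sym => p12 /and3P[p2l + +].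
rewrite -joiningP // => /andP[p1l1 p2l1].
rewrite -joiningP // => /andP[p2l2 pl2].
rewrite p1l p1l1 p2l1 p2l2 pl2 /=; apply/and4P; split.
- by apply/andP; split;
    [apply: contraNneq p1x => -[->] | apply: contraNneq p2x => -[->]].
- by apply/andP; split; apply: contraNneq p2l => -[->].
- by apply: contraNneq p12 => -[->].
apply: contraNneq p2l => -[eq_l].
have /eqP l_eq : l == joining p1 p by rewrite -joiningP // p1l.
have /eqP l1_eq : l1 == joining p1 p by rewrite -joiningP // p1l1 eq_l.
by rewrite l_eq -l1_eq.
Qed.

(** The vertices that follow (x, y) and the line of slope m through it.
    Measuring the horizontal offset of p' in units of u turns the requirement
    that its abscissa differ from x and x + u into a condition on r alone. *)
Definition hexagon (x y m : F) (t : F * F * F) : 4.-tuple B :=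
  let: (u, r, z) := t in
  let p := (x + u, y + m * u) in
  let p' := (x + u * r, y + m * (u * r) + z) in
  [tuple inl p; inr (joining p p'); inl p'; inr (joining p' (x, y))].

Definition hexagon_params : {set F * F * F} :=
  setX (setX [set~ 0] (~: [set 0; 1])) [set~ 0].

Lemma hexagon_inj x y m :
  {in hexagon_params &, injective (hexagon x y m)}.
Proof.
case=> -[u r] z [[v s] w]; rewrite !inE /= => /andP[/andP[nz_u _] _] _.
case=> /addrI eq_u _ _ _ /addrI + + _ _; rewrite -{v}eq_u => /(mulfI nz_u) <-.
by move=> /addrI <-.
Qed.

Lemma mem_hexagons x y m b (s : 4.-tuple B) : incident (x, y) (m, b) ->
  ucycleb (@adj B) [:: inl (x, y), inr (m, b) & s] =
  (s \in hexagon x y m @: hexagon_params).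
Proof.
move=> pl; have /eqP y_l := pl.
apply/idP/imsetP => [|[[[u r] z]]].
  case: s => -[|a [|c [|d [|e []]]]] // s_sz Cs.
  case: a c d e s_sz Cs => [[x1 y1]|?] [?|l1] [[x2 y2]|?] [?|l2] s_sz;
    try by rewrite /ucycleb /= ?andbF.
  rewrite [ucycleb _ _](ucycle6_biaffine _ _ _ _ pl) /=.
  case/and5P=> /eqP y1_l x1x x2x x21 /and3P[p2l /eqP-> /eqP->].
  have nz_u : x1 - x != 0 by rewrite subr_eq0.
  have r_neq1 : (x2 - x) / (x1 - x) != 1.
    by rewrite (can2_eq (divfK nz_u) (mulfK nz_u)) mul1r (inj_eq (addIr _)).
  exists (x1 - x, (x2 - x) / (x1 - x), y2 - (m * x2 + b)).
    by rewrite !inE /= nz_u negb_or r_neq1 mulf_neq0 ?invr_eq0 ?subr_eq0.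
  have p1E : (x + (x1 - x), y + m * (x1 - x)) = (x1, y1).
    by rewrite y_l y1_l; congr (_, _); ring.
  pose u := x1 - x; pose r := (x2 - x) / (x1 - x).
  have p2E : (x + u * r, y + m * (u * r) + (y2 - (m * x2 + b))) = (x2, y2).
    have -> : u * r = x2 - x by rewrite /u /r mulrC divfK.
    by rewrite y_l; congr (_, _); ring.
  by apply: val_inj; rewrite /hexagon p1E p2E.
rewrite !inE /= => /andP[/andP[nz_u /norP[nz_r nz_r1]] nz_z] ->.
rewrite [ucycleb _ _](ucycle6_biaffine _ _ _ _ pl) /= !eqxx /= !andbT.
have neq_x v : v != 0 -> x + v != x by rewrite -{2}[x]addr0 (inj_eq (addrI x)).
apply/and5P; split; rewrite ?neq_x ?mulf_neq0 //.
- by apply/eqP; rewrite y_l; ring.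
- by rewrite (inj_eq (addrI x)) -{2}[u]mulr1 (inj_eq (mulfI nz_u)).
by rewrite -subr_eq0 (_ : _ - _ = z) // y_l; ring.
Qed.

Lemma card_cycles6_through p l : incident p l ->
  #|cycles_through 6 (inl p : B) (inr l)| = ((#|F| - 1) ^ 2 * (#|F| - 2))%N.
Proof.
case: p l => [x y] [m b] pl; rewrite card_cycles_through //.
rewrite (_ : [set s | _] = hexagon x y m @: hexagon_params); last first.
  by apply/setP=> s; rewrite inE mem_hexagons.
rewrite card_in_imset; last exact: hexagon_inj.
rewrite !cardsX cardsC1 cardsCs setCK cards2 eq_sym oner_eq0 /=.
by rewrite subn1 expnS expn1 mulnAC.
Qed.

End BiaffinePlane.

Theorem theorem2p1 (q p k : nat) (F : finFieldType)
    (hp : prime p) (hk : 0 < k) (hqpk : q = p ^ k) (hq : 3 <= q)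
    (hF : #|F| = q) :
  egr (2 * q ^ 2) q 6 ((q - 1) ^ 2 * (q - 2)) (biaffine_graph F).
Proof.
have card_through (x y : biaffine_graph F) :
    adj x y -> #|cycles_through 6 x y| = (q - 1) ^ 2 * (q - 2).
  rewrite -hF; case: x y => [x|x] [y|y] //; first exact: card_cycles6_through.
  by rewrite cycles_throughC; exact: card_cycles6_through.
split=> //; first by rewrite -hF card_biaffine.
  by rewrite -hF; exact: regular_biaffine.
split.
  (* The count is positive, so any edge lies on a 6-cycle. *)
  pose p0 : biaffine_graph F := inl (0, 0)%R.
  pose l0 : biaffine_graph F := inr (0, 0)%R.
  have edge : adj p0 l0 by rewrite /= mul0r addr0.
  have /card_gt0P[C] : 0 < #|cycles_through 6 p0 l0|.
    by rewrite card_through // muln_gt0 expn_gt0 !subn_gt0 hq (ltnW hq).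
  by rewrite inE => /andP[C6 _]; apply/set0Pn; exists C.
move=> n n6; apply: cycles_eq0 => s sz_s n3.
have [n4|neq4] := eqVneq n 4; first by rewrite no_cycle4_biaffine ?sz_s.
apply: contraL (n3) => /andP[/odd_cycle_biaffine].
by rewrite sz_s; case: n n6 neq4 {n3 sz_s} => [|[|[|[|[|[|]]]]]].
Qed.
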